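(* Let $\Theta\subseteq\mathbb{R}^d$, let $F_\theta\in\mathbb{S}^N$ depend continuously on $\theta\in\Theta$, let $G^1,\dots,G^m\in\mathbb{S}^N$ and $c=(c^1,\dots,c^m)\in\mathbb{R}^m$ with $c\neq 0$, and consider the family of problems $$(Q_\theta)\qquad \min_{x\in\mathbb{R}^N}\ f_\theta(x):=x^\top F_\theta x\quad\text{s.t.}\quad g^i(x):=x^\top G^i x+c^i=0,\quad i=1,\dots,m.$$ Let $\mathbf{X}=\{x\in\mathbb{R}^N: g(x)=0\}$, where $g=(g^1,\dots,g^m)$. Let $\bar\theta\in\Theta$ be such that $F_{\bar\theta}\succeq 0$, $F_{\bar\theta}$ has corank one, and the optimal value of $(Q_{\bar\theta})$ is $0$, attained at $\bar x$ (which is then unique up to sign). If $\mathrm{ACQ}_{\mathbf{X}}(\bar x)$ holds, then $(Q_\theta)$ is SDP-stable near $\bar\theta$, and for $\theta$ near $\bar\theta$ the primal SDP relaxation $(P_\theta)$ recovers the minimizer of $(Q_\theta)$.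
   Context: $\mathbb{S}^N$ is the space of real symmetric $N\times N$ matrices, $A\bullet B$ is the trace inner product, and the corank of an $N\times N$ matrix is $N$ minus its rank. The primal and dual SDP relaxations of $(Q_\theta)$ are $$(P_\theta)\quad \min_{S\in\mathbb{S}^N} F_\theta\bullet S\ \text{ s.t. } G^i\bullet S+c^i=0\ (i=1,\dots,m),\ S\succeq0;\qquad (D_\theta)\quad \max_{\lambda\in\mathbb{R}^m}\ \sum_i\lambda_i c^i\ \text{ s.t. } F_\theta+\sum_i\lambda_iG^i\succeq0.$$ $\mathrm{val}$ denotes the optimal value. The family $(Q_\theta)$ is SDP-stable near $\bar\theta$ if there is a neighborhood of $\bar\theta$ (in $\Theta$) on which $\mathrm{val}(Q_\theta)=\mathrm{val}(P_\theta)=\mathrm{val}(D_\theta)$. ''$(P_\theta)$ recovers the minimizer'' means that $(P_\theta)$ has a unique optimal solution, and it is of the form $xx^\top$ with $x$ an optimal solution of $(Q_\theta)$ (unique up to sign). Abadie constraint qualification: for a map $g:\mathbb{R}^N\to\mathbb{R}^m$ with zero set $\mathbf{X}$ and $x\in\mathbf{X}$, $\mathrm{ACQ}_{\mathbf{X}}(x)$ holds if $\mathbf{X}$ is a smooth manifold near $x$ and $\mathrm{rank}\,\nabla g(x)=\mathrm{codim}_x\mathbf{X}:=N-\dim_x\mathbf{X}$, where $\nabla g$ is the Jacobian matrix and $\dim_x$ the local dimension at $x$. *)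

(* Defs.v *)
From HB Require Import structures.
From mathcomp Require Import all_boot all_order all_algebra.
From mathcomp Require Import all_classical all_reals all_analysis.

Set Implicit Arguments.
Unset Strict Implicit.
Unset Printing Implicit Defensive.
Import Order.TTheory GRing.Theory Num.Theory.
Import numFieldNormedType.Exports.

Local Open Scope classical_set_scope.
Local Open Scope ring_scope.

(* Points of R^N are row vectors, as required by the library Jacobian 'J;
   thus x^T A x is written x *m A *m x^T and x x^T is written x^T *m x. *)

Section SymmetricMatrices.
Variables (R : realType) (N : nat).
Implicit Types (A B : 'M[R]_N) (x : 'rV[R]_N).

Definition qform A x : R := (x *m A *m x^T) 0 0.

Definition symmetric_mx A : Prop := A^T = A.

Definition psd A : Prop := symmetric_mx A /\ forall x, 0 <= qform A x.

Definition mxdot A B : R := \tr (A^T *m B).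

Definition corank A : nat := (N - \rank A)%N.

End SymmetricMatrices.

Section Manifolds.
Variable R : realType.

(* f is of class C^n on the open set U. *)
Fixpoint Ck_on (p q n : nat) (U : set 'rV[R]_p) (f : 'rV[R]_p -> 'rV[R]_q)
    : Prop :=
  match n with
  | 0 => forall x, U x -> {for x, continuous f}
  | n'.+1 => (forall x, U x -> differentiable f x) /\
             (forall v, Ck_on n' U (fun x => 'D_v f x))
  end.

Definition smooth_on (p q : nat) (U : set 'rV[R]_p)
    (f : 'rV[R]_p -> 'rV[R]_q) : Prop := forall n, Ck_on n U f.

(* phi is a C^infinity diffeomorphism from U onto V with inverse psi. *)
Definition diffeo (N : nat) (U V : set 'rV[R]_N)
    (phi psi : 'rV[R]_N -> 'rV[R]_N) : Prop :=
  [/\ forall x, U x -> V (phi x) /\ psi (phi x) = x,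
      forall y, V y -> U (psi y) /\ phi (psi y) = y,
      smooth_on U phi & smooth_on V psi].

(* Near x, the set X is a smooth (embedded) submanifold of R^N of dimension k:
   some local diffeomorphism of R^N straightens X to R^k x {0}.
   The dimension k is determined by X and x. *)
Definition smooth_manifold_near (N : nat) (X : set 'rV[R]_N) (x : 'rV[R]_N)
    (k : nat) : Prop :=
  X x /\ (k <= N)%N /\
  exists U V : set 'rV[R]_N, exists phi psi : 'rV[R]_N -> 'rV[R]_N,
    [/\ open U, open V, U x, diffeo U V phi psi &
        forall y, U y ->
          (X y <-> forall i : 'I_N, (k <= i)%N -> phi y 0 i = 0)].

Definition zero_set (N m : nat) (g : 'rV[R]_N -> 'rV[R]_m) : set 'rV[R]_N :=
  [set x | g x = 0].

Definition ACQ (N m : nat) (g : 'rV[R]_N -> 'rV[R]_m) (x : 'rV[R]_N) : Prop :=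
  exists k : nat, smooth_manifold_near (zero_set g) x k /\
                  \rank ('J g x) = (N - k)%N.

End Manifolds.

(* A is the cost matrix F_theta. *)
Section Problems.
Variables (R : realType) (N m : nat).
Variables (A : 'M[R]_N) (G : 'I_m -> 'M[R]_N) (c : 'rV[R]_m).

Definition constraint (x : 'rV[R]_N) : 'rV[R]_m :=
  \row_i (qform (G i) x + c 0 i).

Definition Q_feasible : set 'rV[R]_N := zero_set constraint.

Definition P_feasible : set 'M[R]_N :=
  [set S | psd S /\ forall i, mxdot (G i) S + c 0 i = 0].

Definition D_feasible : set 'rV[R]_m :=
  [set l | psd (A + \sum_i l 0 i *: G i)].

(* Extended-real optimal values: an infeasible minimization problem has value
   +oo, an infeasible maximization problem has value -oo. *)
Definition Q_val : \bar R := ereal_inf [set (qform A x)%:E | x in Q_feasible].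

Definition P_val : \bar R := ereal_inf [set (mxdot A S)%:E | S in P_feasible].

Definition D_val : \bar R :=
  ereal_sup [set (\sum_i l 0 i * c 0 i)%:E | l in D_feasible].

Definition Q_optimal (x : 'rV[R]_N) : Prop :=
  Q_feasible x /\ forall y, Q_feasible y -> qform A x <= qform A y.

Definition P_optimal (S : 'M[R]_N) : Prop :=
  P_feasible S /\ forall T, P_feasible T -> mxdot A S <= mxdot A T.

Definition P_recovers_minimizer : Prop :=
  exists x : 'rV[R]_N,
    [/\ Q_optimal x, forall y, Q_optimal y -> y = x \/ y = - x,
        P_optimal (x^T *m x) & forall S, P_optimal S -> S = x^T *m x].

End Problems.

Definition SDP_stable_near (R : realType) (d N m : nat) (Theta : set 'rV[R]_d)
    (F : 'rV[R]_d -> 'M[R]_N) (G : 'I_m -> 'M[R]_N) (c : 'rV[R]_m)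
    (theta0 : 'rV[R]_d) : Prop :=
  \forall theta \near within Theta (nbhs theta0),
    Q_val (F theta) G c = P_val (F theta) G c /\
    P_val (F theta) G c = D_val (F theta) G c.

(* Main.v *)
Require Import Defs.
From HB Require Import structures.
From mathcomp Require Import all_boot all_order all_algebra.
From mathcomp Require Import all_classical all_reals all_analysis.
From mathcomp Require Import ring lra.

(** Why the relaxation is tight near [thetabar]. A pair made of a feasible [x]
    and multipliers [l] proves global optimality of [x], for the quadratic problem
    and for both relaxations, as soon as the Lagrangian matrix
    [H = F theta + \sum_i l i G^i] is positive semidefinite with kernel spanned
    by [x]: weak duality equates the three values, complementary slackness forces
    every primal solution to be a multiple of [x x^T], and [c != 0] fixes the
    multiple ([certificate_Q_val], [certificate_P_val], [certificate_D_val],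
    [certificate_recovers]). The certificate turns local information into global
    optimality, so it is enough to produce one such pair near [xbar].

    At [thetabar] the pair is [xbar] with zero multipliers. For a nearby [theta],
    minimizing over the feasible points of a small closed ball around [xbar] gives
    a local minimizer [x] close to [xbar], because [xbar] is a strict local
    minimizer at [thetabar] ([perturbed_local_minimizer]). Differentiating along
    curves of the manifold gives the first-order condition that [x F theta] is
    normal to the feasible set at [x] ([tangent_matrix]). The constraint
    qualification makes the constraint gradients span this normal space, with
    uniformly bounded coefficients near [xbar], so [x] has multipliers bounded by
    a constant times the norm of [x F theta], which tends to [0]
    ([small_multiplier]).

    Consequently [H] is close to [F thetabar], and [x H = 0]. A positive
    semidefinite matrix of corank one remains so under small symmetric
    perturbations that keep a kernel vector near the original kernel
    ([psd_corank1_stable]); this is the required property of [H]. All closeness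
    claims are quantified with the sup norm of matrices, which is submultiplicative
    up to the inner dimension ([norm_mulmx_le]). *)

Set Implicit Arguments.
Unset Strict Implicit.
Unset Printing Implicit Defensive.
Import Order.TTheory GRing.Theory Num.Theory.
Import numFieldNormedType.Exports.

Local Open Scope classical_set_scope.
Local Open Scope ring_scope.

(** * Quadratic forms and positive semidefinite matrices *)

Section QuadraticForms.
Variables (R : realType) (N : nat).
Implicit Types (A B S : 'M[R]_N) (x y z : 'rV[R]_N).

Definition bform A x y : R := (x *m A *m y^T) 0 0.

Lemma bformDl A x y z : bform A (x + y) z = bform A x z + bform A y z.
Proof. by rewrite /bform !mulmxDl mxE. Qed.

Lemma bformDr A x y z : bform A x (y + z) = bform A x y + bform A x z.
Proof. by rewrite /bform linearD /= mulmxDr mxE. Qed.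

Lemma bformZl A a x y : bform A (a *: x) y = a * bform A x y.
Proof. by rewrite /bform -!scalemxAl mxE. Qed.

Lemma bformZr A a x y : bform A x (a *: y) = a * bform A x y.
Proof. by rewrite /bform linearZ /= -scalemxAr mxE. Qed.

Lemma bformC A x y : symmetric_mx A -> bform A x y = bform A y x.
Proof.
move=> symA; rewrite /bform -[in LHS](trmxK (x *m A *m y^T)) [LHS]mxE.
by rewrite !trmx_mul trmxK symA mulmxA.
Qed.

Lemma qform_bform A x : qform A x = bform A x x.
Proof. by []. Qed.

Lemma qformMD A B x : qform (A + B) x = qform A x + qform B x.
Proof. by rewrite /qform mulmxDr mulmxDl mxE. Qed.

Lemma qformMZ a A x : qform (a *: A) x = a * qform A x.
Proof. by rewrite /qform -scalemxAr -scalemxAl mxE. Qed.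

Lemma qformMB A B x : qform (A - B) x = qform A x - qform B x.
Proof. by rewrite -scaleN1r qformMD qformMZ mulN1r. Qed.

Lemma qform_sum (I : finType) (M : I -> 'M[R]_N) x :
  qform (\sum_i M i) x = \sum_i qform (M i) x.
Proof.
by rewrite /qform mulmx_sumr mulmx_suml summxE.
Qed.

Lemma qformD A x y : symmetric_mx A ->
  qform A (x + y) = qform A x + 2 * bform A x y + qform A y.
Proof.
move=> symA; rewrite !qform_bform !bformDl !bformDr (bformC y x symA); ring.
Qed.

Lemma qformZ A a x : qform A (a *: x) = a ^+ 2 * qform A x.
Proof. by rewrite !qform_bform bformZl bformZr mulrA expr2. Qed.

Lemma qform_rank1 x y : qform (x^T *m x) y = (y *m x^T) 0 0 ^+ 2.
Proof.
rewrite /qform mulmxA -mulmxA mxE big_ord1 expr2; congr (_ * _).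
by rewrite -[in RHS](trmxK (y *m x^T)) [RHS]mxE trmx_mul trmxK.
Qed.

Lemma mulmx_bform0 A x : (forall y, bform A x y = 0) -> x *m A = 0.
Proof.
move=> bA0; apply/rowP => j; rewrite [RHS]mxE -(bA0 (delta_mx 0 j)) /bform.
by rewrite trmx_delta -colE [RHS]mxE.
Qed.

(** Along the line [y + t x] the form is affine in [t] because its quadratic
    coefficient [qform A x] vanishes; being nonnegative, it has slope zero. *)
Lemma psd_qform0 A x : psd A -> qform A x = 0 -> x *m A = 0.
Proof.
move=> [symA A_ge0] qx0; apply: mulmx_bform0 => y.
apply/eqP/negPn/negP => b_neq0.
have := A_ge0 (y + (- (qform A y + 1) / (2 * bform A x y)) *: x).
rewrite qformD // qformZ qx0 bformZr (bformC y x symA).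
set b := bform A x y in b_neq0 *.
have -> : 2 * (- (qform A y + 1) / (2 * b) * b) = - (qform A y + 1).
  by field.
lra.
Qed.

Lemma psd_cauchy_schwarz A x y :
  psd A -> bform A x y ^+ 2 <= qform A x * qform A y.
Proof.
move=> Apsd; have [symA A_ge0] := Apsd.
have [qy0|qy_neq0] := eqVneq (qform A y) 0.
  rewrite (bformC x y symA) /bform (psd_qform0 Apsd qy0) mul0mx mxE.
  by rewrite qy0 expr0n mulr0.
have qy_gt0 : 0 < qform A y by rewrite lt_def qy_neq0 A_ge0.
have := A_ge0 (qform A y *: x + (- bform A x y) *: y).
rewrite qformD // !qformZ bformZl bformZr.
set b := bform A x y; set p := qform A x; set q := qform A y in qy_gt0 *.
have -> : q ^+ 2 * p + 2 * (q * (- b * b)) + (- b) ^+ 2 * q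
  = q * (p * q - b ^+ 2) by ring.
by rewrite pmulr_rge0 // subr_ge0.
Qed.

(** Symmetric Gaussian elimination: subtracting the rank-one matrix built from a
    nonzero row, whose diagonal entry is then positive, clears that row. By
    Cauchy-Schwarz the difference stays positive semidefinite, and rows that were
    zero stay zero, so the number of nonzero rows drops. *)
Lemma psd_rank1_decomposition S : psd S ->
  exists s : seq 'rV[R]_N, S = \sum_(v <- s) v^T *m v.
Proof.
have [n] := ubnP #|[pred i | row i S != 0]|.
elim: n S => // n IHn S; rewrite ltnS => cardS Spsd.
have [symS S_ge0] := Spsd.
have [S0|/matrix0Pn [i [j Sij]]] := eqVneq S 0.
  by exists [::]; rewrite big_nil.
have rowi : row i S != 0.
  by apply/negP => /eqP/rowP/(_ j); rewrite !mxE => /eqP; apply/negP.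
pose e : 'rV[R]_N := delta_mx 0 i.
have eS : e *m S = row i S by rewrite /e -rowE.
have qe_gt0 : 0 < qform S e.
  rewrite lt_def S_ge0 andbT; apply: contra rowi => /eqP qe0.
  by rewrite -eS (psd_qform0 Spsd qe0).
set q := qform S e in qe_gt0.
pose v := (Num.sqrt q)^-1 *: (e *m S).
have vvE : v^T *m v = q^-1 *: ((e *m S)^T *m (e *m S)).
  rewrite /v [(_ *: _)^T]linearZ /= -scalemxAl -scalemxAr scalerA -invfM -expr2.
  by rewrite sqr_sqrtr // ltW.
pose S' := S - v^T *m v.
have symS' : symmetric_mx S'.
  by rewrite /symmetric_mx /S' linearB /= symS trmx_mul trmxK.
have S'psd : psd S'.
  split=> // y; rewrite /S' vvE qformMB qformMZ qform_rank1.
  have -> : (y *m (e *m S)^T) 0 0 = bform S y e.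
    by rewrite /bform trmx_mul symS mulmxA.
  have := psd_cauchy_schwarz y e Spsd; rewrite -/q => CS.
  by rewrite subr_ge0 ler_pdivrMl // mulrC.
have [|s S'E] := IHn S' _ S'psd; last first.
  by exists (v :: s); rewrite big_cons -S'E addrC subrK.
apply: leq_trans cardS; apply: proper_card; apply/properP; split.
  apply/fintype.subsetP => k; rewrite !inE; apply: contra => /eqP rowk0.
  have k_S : delta_mx 0 k *m S = 0 :> 'rV_N by rewrite -rowE.
  have k_eS : (delta_mx 0 k : 'rV_N) *m (e *m S)^T = 0.
    by rewrite trmx_mul symS mulmxA k_S mul0mx.
  rewrite rowE /S' vvE mulmxBr k_S -scalemxAr (mulmxA (delta_mx 0 k)) k_eS.
  by rewrite mul0mx scaler0 subr0.
exists i; rewrite !inE ?rowi // negbK rowE -/e /S' vvE mulmxBr.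
have e_eS : e *m (e *m S)^T = q%:M.
  by rewrite trmx_mul symS mulmxA [LHS]mx11_scalar.
rewrite -scalemxAr (mulmxA e) e_eS mul_scalar_mx scalerA mulVf ?lt0r_neq0 //.
by rewrite scale1r subrr.
Qed.

Lemma mxdot_rank1 A x : symmetric_mx A -> mxdot A (x^T *m x) = qform A x.
Proof.
move=> symA; rewrite /mxdot symA mulmxA mxtrace_mulC mulmxA.
by rewrite /mxtrace big_ord1.
Qed.

Lemma mxdot_sumr A (s : seq 'rV[R]_N) : symmetric_mx A ->
  mxdot A (\sum_(v <- s) v^T *m v) = \sum_(v <- s) qform A v.
Proof.
move=> symA; rewrite /mxdot mulmx_sumr raddf_sum /=.
by apply: eq_bigr => v _; rewrite -mxdot_rank1.
Qed.

Lemma mxdot_psd_ge0 A S : psd A -> psd S -> 0 <= mxdot A S.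
Proof.
move=> [symA A_ge0] /psd_rank1_decomposition [s ->].
by rewrite mxdot_sumr //; apply: sumr_ge0.
Qed.

(** Complementary slackness for [A] of corank one: when [S] is decomposed into
    rank-one terms, [mxdot A S] is a sum of nonnegative values of the form, so
    each of the vectors that make up [S] lies on the kernel line of [A]. *)
Lemma mxdot_psd_eq0 A S x : psd A -> psd S ->
  (forall v, qform A v = 0 -> exists a, v = a *: x) ->
  mxdot A S = 0 -> exists t, S = t *: (x^T *m x).
Proof.
move=> [symA A_ge0] /psd_rank1_decomposition [s ->] kerA.
rewrite mxdot_sumr // => /eqP; rewrite psumr_eq0 // => /allP s0.
rewrite big_seq_cond.
elim/big_ind : _ => [|_ _ [a ->] [b ->]|v /andP[vs _]].
- by exists 0; rewrite scale0r.
- by exists (a + b); rewrite scalerDl.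
have /= /eqP /kerA [a ->] := s0 v vs.
exists (a * a); rewrite [(_ *: _)^T]linearZ /= -scalemxAl -scalemxAr scalerA //.
Qed.

End QuadraticForms.

(** * Optimality certificates *)

Section Certificates.
Variables (R : realType) (N m : nat).
Variables (A : 'M[R]_N) (G : 'I_m -> 'M[R]_N) (c : 'rV[R]_m).
Hypotheses (A_sym : symmetric_mx A) (G_sym : forall i, symmetric_mx (G i)).
Implicit Types (x y : 'rV[R]_N) (S : 'M[R]_N) (l : 'rV[R]_m).

Definition lagrangian_mx l : 'M[R]_N := A + \sum_i l 0 i *: G i.

Lemma Q_feasibleP x :
  Q_feasible G c x <-> forall i, qform (G i) x + c 0 i = 0.
Proof.
rewrite /Q_feasible /zero_set /constraint /=; split=> [/rowP gx i|gx].
  by have := gx i; rewrite !mxE.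
by apply/rowP => i; rewrite !mxE.
Qed.

Lemma lagrangian_mx_sym l : symmetric_mx (lagrangian_mx l).
Proof.
rewrite /symmetric_mx /lagrangian_mx linearD /= A_sym linear_sum /=.
by congr (_ + _); apply: eq_bigr => i _; rewrite linearZ /= G_sym.
Qed.

Lemma qform_lagrangian x l : Q_feasible G c x ->
  qform (lagrangian_mx l) x = qform A x - \sum_i l 0 i * c 0 i.
Proof.
move=> /Q_feasibleP gx; rewrite qformMD qform_sum -sumrN; congr (_ + _).
apply: eq_bigr => i _; rewrite qformMZ -mulrN; congr (_ * _).
by apply/eqP; rewrite -addr_eq0 gx.
Qed.

Lemma mxdot_lagrangian S l : P_feasible G c S ->
  mxdot (lagrangian_mx l) S = mxdot A S - \sum_i l 0 i * c 0 i.
Proof.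
move=> [_ gS]; rewrite /mxdot linearD mulmxDl mxtraceD -sumrN; congr (_ + _).
rewrite linear_sum mulmx_suml raddf_sum /=; apply: eq_bigr => i _.
rewrite linearZ -scalemxAl mxtraceZ -mulrN; congr (_ * _).
by apply/eqP; rewrite -addr_eq0 -/(mxdot _ _) gS.
Qed.

Lemma P_feasible_rank1 x : Q_feasible G c x -> P_feasible G c (x^T *m x).
Proof.
move=> /Q_feasibleP gx; split=> [|i]; last by rewrite mxdot_rank1.
split=> [|y]; first by rewrite /symmetric_mx trmx_mul trmxK.
by rewrite qform_rank1 sqr_ge0.
Qed.

(** A nonzero [c] pins down the scale: of all multiples of a feasible [x x^T],
    only [x x^T] itself satisfies the constraints. *)
Lemma feasible_scaling_eq1 x t : c != 0 -> Q_feasible G c x ->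
  (forall i, t * qform (G i) x + c 0 i = 0) -> t = 1.
Proof.
move=> /matrix0Pn [k [i]]; rewrite ord1 => ci_neq0 /Q_feasibleP/(_ i)/eqP.
rewrite addr_eq0 => /eqP gx /(_ i)/eqP.
rewrite gx mulrN addrC -{1}[c 0 i]mul1r -mulrBl mulf_eq0.
by rewrite (negbTE ci_neq0) orbF subr_eq0 => /eqP.
Qed.

Lemma Q_feasible_colinear x a : c != 0 ->
  Q_feasible G c x -> Q_feasible G c (a *: x) -> a *: x = x \/ a *: x = - x.
Proof.
move=> c_neq0 x_feas /Q_feasibleP ax_feas.
have /eqP : a ^+ 2 = 1.
  by apply: feasible_scaling_eq1 x_feas _ => // i; rewrite -qformZ.
rewrite sqrf_eq1 => /orP[] /eqP ->; [left|right].
  by rewrite scale1r.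
by rewrite scaleN1r.
Qed.

(** From here on, [x] and [l] certify global optimality: [l] is dual feasible
    and [x] spans the kernel of the resulting matrix. Weak duality then pins all
    three values to [qform A x], and complementary slackness makes [x x^T] the
    only primal solution. *)
Variables (x : 'rV[R]_N) (l : 'rV[R]_m).
Hypotheses (c_neq0 : c != 0) (x_feasible : Q_feasible G c x).
Hypothesis H_psd : psd (lagrangian_mx l).
Hypothesis H_x : qform (lagrangian_mx l) x = 0.
Hypothesis H_ker :
  forall v, qform (lagrangian_mx l) v = 0 -> exists a, v = a *: x.

Lemma certificate_value : \sum_i l 0 i * c 0 i = qform A x.
Proof.
by apply/esym/eqP; rewrite -subr_eq0 -qform_lagrangian // H_x.
Qed.

Lemma certificate_P_bound S : P_feasible G c S -> qform A x <= mxdot A S.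
Proof.
move=> fS; rewrite -certificate_value -subr_ge0 -mxdot_lagrangian //.
by apply: mxdot_psd_ge0 => //; case: fS.
Qed.

Lemma certificate_Q_bound y : Q_feasible G c y -> qform A x <= qform A y.
Proof.
by move=> /P_feasible_rank1/certificate_P_bound; rewrite mxdot_rank1.
Qed.

Lemma certificate_Q_val : Q_val A G c = (qform A x)%:E.
Proof.
apply/eqP; rewrite eq_le; apply/andP; split.
  by apply: ereal_inf_lbound; exists x.
by apply: le_ereal_inf_tmp => _ [y fy <-]; rewrite lee_fin certificate_Q_bound.
Qed.

Lemma certificate_P_val : P_val A G c = (qform A x)%:E.
Proof.
apply/eqP; rewrite eq_le; apply/andP; split.
  apply: ereal_inf_lbound; exists (x^T *m x); last by rewrite mxdot_rank1.
  exact: P_feasible_rank1.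
by apply: le_ereal_inf_tmp => _ [S fS <-]; rewrite lee_fin certificate_P_bound.
Qed.

Lemma certificate_D_val : D_val A G c = (qform A x)%:E.
Proof.
apply/eqP; rewrite eq_le; apply/andP; split.
  apply: ge_ereal_sup => _ [k [_ k_ge0] <-].
  by rewrite lee_fin -subr_ge0 -qform_lagrangian.
by apply: ereal_sup_ubound; exists l; last rewrite certificate_value.
Qed.

Lemma certificate_recovers : P_recovers_minimizer A G c.
Proof.
have opt_val S : P_optimal A G c S -> mxdot (lagrangian_mx l) S = 0.
  move=> [fS S_min]; rewrite mxdot_lagrangian // certificate_value.
  apply/eqP; rewrite subr_eq0 eq_le certificate_P_bound // andbT.
  by rewrite -mxdot_rank1 //; apply/S_min/P_feasible_rank1.
exists x; split.
- by split=> // y; exact: certificate_Q_bound.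
- move=> y [fy y_min].
  have [a ya] : exists a, y = a *: x.
    apply: H_ker; rewrite qform_lagrangian // certificate_value.
    by apply/eqP; rewrite subr_eq0 eq_le y_min // certificate_Q_bound.
  by rewrite ya in fy *; exact: Q_feasible_colinear fy.
- split; first exact: P_feasible_rank1.
  by move=> T fT; rewrite mxdot_rank1 // certificate_P_bound.
move=> S S_opt; have [[S_psd gS] _] := S_opt.
have [t SE] := mxdot_psd_eq0 H_psd S_psd H_ker (opt_val _ S_opt).
suff t1 : t = 1 by rewrite SE t1 scale1r.
apply: feasible_scaling_eq1 x_feasible _ => // i.
by rewrite -(gS i) SE /mxdot -scalemxAr mxtraceZ -/(mxdot _ _) mxdot_rank1.
Qed.

End Certificates.

(** * Sup-norm estimates and differentiability of quadratic maps *)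

Section MatrixNorm.
Variable R : realType.

Lemma mx_entry_le_norm m n (A : 'M[R]_(m, n)) i j : `|A i j| <= `|A|.
Proof.
rewrite [leRHS]/Num.norm /= mx_normrE.
by apply/bigmax_geP; right => /=; exists (i, j).
Qed.

Lemma mx_norm_le m n (A : 'M[R]_(m, n)) (a : R) : 0 <= a ->
  (forall i j, `|A i j| <= a) -> `|A| <= a.
Proof.
by move=> a_ge0 Aa; rewrite [leLHS]/Num.norm /= mx_normrE; apply/bigmax_leP.
Qed.

Lemma norm_trmx m n (A : 'M[R]_(m, n)) : `|A^T| = `|A|.
Proof.
apply/eqP; rewrite eq_le; apply/andP; split; apply: mx_norm_le => // i j.
  by rewrite mxE mx_entry_le_norm.
by rewrite -[A]trmxK mxE trmxK mx_entry_le_norm.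
Qed.

Lemma norm_mulmx_le m n p (A : 'M[R]_(m, n)) (B : 'M[R]_(n, p)) :
  `|A *m B| <= n%:R * `|A| * `|B|.
Proof.
apply: mx_norm_le => [|i j]; first by rewrite !mulr_ge0.
rewrite mxE (le_trans (ler_norm_sum _ _ _)) //.
have -> : n%:R * `|A| * `|B| = \sum_(k < n) `|A| * `|B|.
  by rewrite sumr_const card_ord -mulrA mulr_natl.
by apply: ler_sum => k _; rewrite normrM ler_pM // mx_entry_le_norm.
Qed.

Lemma bform_norm_le N (A : 'M[R]_N) (x y : 'rV[R]_N) :
  `|bform A x y| <= N%:R ^+ 2 * `|A| * `|x| * `|y|.
Proof.
rewrite (le_trans (mx_entry_le_norm _ _ _)) //.
rewrite (le_trans (norm_mulmx_le _ _)) // norm_trmx.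
rewrite ler_wpM2r // expr2 -!mulrA ler_wpM2l // mulrA mulrAC.
exact: norm_mulmx_le.
Qed.

Lemma qform_norm_le N (A : 'M[R]_N) (x : 'rV[R]_N) :
  `|qform A x| <= N%:R ^+ 2 * `|A| * `|x| ^+ 2.
Proof. by rewrite expr2 mulrA; exact: bform_norm_le. Qed.

End MatrixNorm.

Section QuadraticMaps.
Variable R : realType.

Lemma is_diff_quadratic (V W : normedModType R) (f : V -> W)
    (df : {linear V -> W}) (x : V) (K C : R) :
  (forall v, `|df v| <= K * `|v|) ->
  (forall v, `|f (v + x) - f x - df v| <= C * `|v| ^+ 2) ->
  is_diff x f df.
Proof.
move=> dfK fC.
have df_cont : continuous df.
  apply: bounded_linear_continuous; apply/bounded_funP => r.
  exists (`|K| * `|r|) => v vr; apply: le_trans (dfK v) _.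
  apply: le_trans (ler_norm _) _; rewrite normrM ler_wpM2l // normr_id.
  exact: le_trans vr (ler_norm r).
have df_o : f \o shift x = cst (f x) + df +o_ 0 id.
  apply/eqaddoP => e e_gt0; near=> v.
  have -> : (f \o shift x - (cst (f x) + df)) v = f (v + x) - f x - df v.
    by rewrite opprD addrA.
  apply: le_trans (fC v) _; rewrite expr2 mulrA ler_wpM2r //=.
  apply: le_trans (_ : (`|C| + 1) * `|v| <= _).
    by rewrite ler_wpM2r // (le_trans (ler_norm C)) // lerDl.
  rewrite mulrC -ler_pdivlMr //; near: v; apply/nbhs_norm0P => /=.
  exists (e / (`|C| + 1)); last by move=> w /= /ltW.
  by rewrite /= divr_gt0 // ltr_wpDl.
have dE := diff_unique df_cont df_o.
by apply: DiffDef => //; apply/diff_locallyP; rewrite dE.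
Unshelve. all: by end_near. Qed.

Variable N : nat.
Implicit Types (A : 'M[R]_N) (x : 'rV[R]_N).

Definition dqform A x (v : 'rV[R]_N) : R := 2 * bform A x v.

Fact dqform_is_linear A x : linear (dqform A x).
Proof.
move=> a u v; rewrite /dqform bformDr bformZr mulrDr; congr (_ + _).
by rewrite mulrCA.
Qed.

HB.instance Definition _ A x :=
  GRing.isLinear.Build R 'rV[R]_N R _ (dqform A x) (dqform_is_linear A x).

Lemma is_diff_qform A x : symmetric_mx A -> is_diff x (qform A) (dqform A x).
Proof.
move=> symA; apply: (@is_diff_quadratic _ _ _ _ x
  (2 * (N%:R ^+ 2 * `|A| * `|x|)) (N%:R ^+ 2 * `|A|)) => v.
  rewrite /dqform normrM gtr0_norm // -[leRHS]mulrA ler_wpM2l //.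
  exact: bform_norm_le.
rewrite [v + x]addrC.
have -> : qform A (x + v) - qform A x - dqform A x v = qform A v.
  by rewrite qformD // /dqform; ring.
exact: qform_norm_le.
Qed.

Lemma continuous_qform A : symmetric_mx A -> continuous (qform A).
Proof.
move=> symA x; have [qx _] := is_diff_qform x symA.
exact: differentiable_continuous.
Qed.

Variables (m : nat) (G : 'I_m -> 'M[R]_N) (c : 'rV[R]_m).
Hypothesis G_sym : forall i, symmetric_mx (G i).

(** Half the transposed Jacobian of the constraint map: its rows [x G^i] are
    half the constraint gradients. *)
Definition grad_mx x : 'M[R]_(m, N) := \matrix_i (x *m G i).

Lemma row_grad_mx x i : row i (grad_mx x) = x *m G i.
Proof. by rewrite rowK. Qed.

Lemma mul_grad_mx (l : 'rV[R]_m) x :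
  l *m grad_mx x = x *m \sum_i l 0 i *: G i.
Proof.
rewrite mulmx_sum_row mulmx_sumr; apply: eq_bigr => i _.
by rewrite row_grad_mx scalemxAr.
Qed.

Lemma grad_mxB x y : grad_mx x - grad_mx y = grad_mx (x - y).
Proof. by apply/row_matrixP => i; rewrite linearB /= !row_grad_mx mulmxBl. Qed.

Lemma grad_mx_norm_le x : `|grad_mx x| <= N%:R * `|x| * \sum_i `|G i|.
Proof.
apply: mx_norm_le => [|i j].
  by rewrite !mulr_ge0 // sumr_ge0.
rewrite mxE (le_trans (mx_entry_le_norm _ _ _)) //.
rewrite (le_trans (norm_mulmx_le _ _)) // ler_wpM2l ?mulr_ge0 //.
by rewrite (bigD1 i) //= lerDl sumr_ge0.
Qed.

Lemma is_diff_constraint x :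
  is_diff x (constraint G c) (mulmxr (2 *: (grad_mx x)^T)).
Proof.
have entryE (v : 'rV[R]_N) i :
    (v *m (2 *: (grad_mx x)^T)) 0 i = 2 * bform (G i) x v.
  rewrite -scalemxAr mxE /bform; congr (_ * _); rewrite mxE [RHS]mxE.
  by apply: eq_bigr => k _; rewrite mulrC !mxE.
apply: (@is_diff_quadratic _ _ _ _ x
  (N%:R * `|2 *: (grad_mx x)^T|) (N%:R ^+ 2 * \sum_i `|G i|)) => v /=.
  by rewrite mulrAC; exact: norm_mulmx_le.
apply: mx_norm_le => [|j i].
  by rewrite !mulr_ge0 // sumr_ge0.
have gE z : constraint G c z 0 i = qform (G i) z + c 0 i by rewrite mxE.
have subE (a b : 'rV[R]_m) : (a - b) 0 i = a 0 i - b 0 i by rewrite !mxE.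
rewrite ord1 !subE entryE !gE [v + x]addrC qformD //.
set q := qform (G i) v; set d := bform _ _ _; set p := qform _ _.
have -> : p + 2 * d + q + c 0 i - (p + c 0 i) - 2 * d = q by ring.
rewrite (le_trans (qform_norm_le _ _)) // ler_wpM2r // ler_wpM2l //.
by rewrite (bigD1 i) //= lerDl sumr_ge0.
Qed.

Lemma continuous_constraint : continuous (constraint G c).
Proof.
move=> x; have [gx _] := is_diff_constraint x.
exact: differentiable_continuous.
Qed.

Lemma jacobian_constraint x : 'J (constraint G c) x = 2 *: (grad_mx x)^T.
Proof.
have [_ dg] := is_diff_constraint x.
apply/row_matrixP => i; rewrite !rowE /jacobian mul_rV_lin1 /=.
by have /(congr1 (fun f => f (delta_mx 0 i))) := dg.
Qed.

End QuadraticMaps.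

(** * Stability of positive semidefinite matrices of corank one *)

Section CorankOne.
Variables (R : realType) (N : nat).
Implicit Types (A H : 'M[R]_N) (v w x : 'rV[R]_N).

Lemma dot_self_eq0 v : (v *m v^T) 0 0 = 0 -> v = 0.
Proof.
rewrite mxE => /eqP; rewrite psumr_eq0 => [/allP v0|i _]; last first.
  by rewrite mxE -expr2 sqr_ge0.
apply/rowP => i; rewrite mxE; have := v0 i (mem_index_enum _).
by rewrite /= mxE mulf_eq0 orbb => /eqP.
Qed.

Lemma psd_corank1_kernel A x v : psd A -> corank A = 1%N ->
  x != 0 -> qform A x = 0 -> qform A v = 0 -> exists a, v = a *: x.
Proof.
move=> Apsd corankA x_neq0 /(psd_qform0 Apsd) xA /(psd_qform0 Apsd) vA.
have x_ker : (x <= kermx A)%MS by apply/sub_kermxP.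
have v_ker : (v <= kermx A)%MS by apply/sub_kermxP.
apply/sub_rVP; apply: submx_trans v_ker _.
rewrite -(mxrank_leqif_sup x_ker) mxrank_ker rank_rV x_neq0.
by move: corankA; rewrite /corank => ->.
Qed.

Lemma pd_coercive A : symmetric_mx A -> (forall v, v != 0 -> 0 < qform A v) ->
  exists2 mu, 0 < mu & forall v, mu * `|v| ^+ 2 <= qform A v.
Proof.
move=> symA A_gt0; pose sphere := [set v : 'rV[R]_N | `|v| = 1].
have unit_sphere v : v != 0 -> sphere (`|v|^-1 *: v).
  by move=> v0; rewrite /sphere /= normrZ normfV normr_id mulVf ?normr_eq0.
have [[u Su]|S0] := pselect (sphere !=set0); last first.
  exists 1 => // v; have [->|v0] := eqVneq v 0; last first.
    by case: S0; exists (`|v|^-1 *: v); apply: unit_sphere.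
  by rewrite normr0 expr0n mulr0 /qform mul0mx mul0mx mxE.
have cptS : compact sphere.
  apply: bounded_closed_compact.
    by exists 1; split=> // r r1 v; rewrite /sphere /= => ->; exact: ltW.
  apply: (@preimage_closed _ _ (fun v : 'rV[R]_N => `|v|) [set r | r = 1]).
    by move=> v _; exact: norm_continuous.
  exact: closed_eq.
have [|u1 Su1 min_u1] := compact_EVT_min (ex_intro _ u Su) cptS
  (f := qform A).
  by apply: continuous_subspaceT; exact: continuous_qform.
move: Su1; rewrite inE /sphere /= => Su1.
exists (qform A u1).
  by apply: A_gt0; rewrite -normr_eq0 Su1 oner_eq0.
move=> v; have [->|v0] := eqVneq v 0.
  by rewrite normr0 expr0n mulr0 /qform mul0mx mul0mx mxE.
have := min_u1 (`|v|^-1 *: v); rewrite inE => /(_ (unit_sphere _ v0)).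
by rewrite qformZ exprVn mulrC ler_pdivlMr ?exprn_gt0 ?normr_gt0.
Qed.

(** [A + x0^T x0] is positive definite, hence coercive, so a small perturbation
    [H] of [A] is still positive definite on the hyperplane orthogonal to [x0].
    A kernel vector [x] of [H] outside this hyperplane complements it, and the
    form [H] ignores the component along [x]. *)
Lemma psd_corank1_stable A x0 : psd A ->
  (forall v, qform A v = 0 -> exists a, v = a *: x0) ->
  exists2 eta, 0 < eta & forall H x, symmetric_mx H -> `|H - A| < eta ->
    (x *m x0^T) 0 0 != 0 -> x *m H = 0 ->
    psd H /\ forall v, qform H v = 0 -> exists a, v = a *: x.
Proof.
move=> [symA A_ge0] kerA.
have symE : symmetric_mx (A + x0^T *m x0).
  by rewrite /symmetric_mx linearD /= symA trmx_mul trmxK.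
have [|mu mu_gt0 E_mu] := pd_coercive symE.
  move=> v v0; rewrite qformMD qform_rank1 lt_def addr_ge0 ?sqr_ge0 // andbT.
  rewrite paddr_eq0 ?sqr_ge0 //; apply: contra v0 => /andP[/eqP/kerA [a va]].
  rewrite sqrf_eq0 => /eqP vx0; apply/eqP/dot_self_eq0.
  by rewrite {2}va linearZ /= -scalemxAr mxE vx0 mulr0.
have N2_gt0 : 0 < N%:R ^+ 2 + 1 :> R by rewrite ltr_wpDl // sqr_ge0.
exists (mu / (N%:R ^+ 2 + 1)); first by rewrite divr_gt0.
move=> H x symH HA xx0 xH.
have H_gt0 w : (w *m x0^T) 0 0 = 0 -> w != 0 -> 0 < qform H w.
  move=> wx0 w0; have w_gt0 : 0 < `|w| ^+ 2 by rewrite exprn_gt0 ?normr_gt0.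
  have := E_mu w; rewrite qformMD qform_rank1 wx0 expr0n addr0 => A_mu.
  have := qform_norm_le (H - A) w; rewrite ler_norml => /andP[HA_ge _].
  have -> : qform H w = qform A w + qform (H - A) w.
    by rewrite qformMB addrC subrK.
  have : N%:R ^+ 2 * `|H - A| * `|w| ^+ 2 < mu * `|w| ^+ 2.
    rewrite ltr_pM2r // -(@divfK _ (N%:R ^+ 2 + 1) _ mu) ?lt0r_neq0 // mulrC.
    apply: le_lt_trans (_ : `|H - A| * (N%:R ^+ 2 + 1) < _).
      by rewrite ler_wpM2l // lerDl.
    by rewrite ltr_pM2r.
  by lra.
have H_split v : exists2 a, ((v - a *: x) *m x0^T) 0 0 = 0 &
    qform H v = qform H (v - a *: x).
  exists ((v *m x0^T) 0 0 / (x *m x0^T) 0 0).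
    rewrite mulmxBl -scalemxAl; move: xx0.
    by move: (v *m _) (x *m _) => p q q0; rewrite !mxE divfK ?subrr.
  rewrite -scaleNr qformD // qformZ bformZr (bformC _ _ symH) (qform_bform H x).
  have xH0 w : bform H x w = 0 by rewrite /bform xH mul0mx mxE.
  by rewrite !xH0 !mulr0 !addr0.
split=> [|v Hv0].
  split=> // v; have [a va ->] := H_split v.
  have [->|v0] := eqVneq (v - a *: x) 0; first by rewrite /qform !mul0mx mxE.
  exact/ltW/H_gt0.
have [a va Hva] := H_split v; exists a.
apply/eqP; rewrite -subr_eq0; apply/negP => /negP /(H_gt0 _ va).
by rewrite -Hva Hv0 ltxx.
Qed.

End CorankOne.

(** * Local minimizers of perturbed objectives *)

Section LocalMinimizers.
Variables (R : realType) (N m : nat) (G : 'I_m -> 'M[R]_N) (c : 'rV[R]_m).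
Hypothesis G_sym : forall i, symmetric_mx (G i).
Implicit Types (A B : 'M[R]_N) (x y : 'rV[R]_N).

Lemma compact_feasible_part (x0 : 'rV[R]_N) (e : R) (D : set R) :
  closed D -> (forall r, D r -> r <= e) ->
  compact [set y | Q_feasible G c y /\ D `|y - x0|].
Proof.
move=> D_closed D_le; apply: bounded_closed_compact.
  exists (`|x0| + e); split; first exact: num_real.
  move=> r r_gt y /= [_ /D_le ye]; apply: ltW; apply: le_lt_trans r_gt.
  by rewrite -[y in leLHS](subrK x0) addrC (le_trans (ler_normD _ _)) // lerD2l.
apply: closedI.
  apply: (@preimage_closed _ _ (constraint G c) [set 0]) => [y _|].
    exact: (continuous_constraint G_sym).
  exact: (compact_closed (@norm_hausdorff _ _) (@compact_set1 _ _)).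
apply: (@preimage_closed _ _ (fun y : 'rV[R]_N => `|y - x0|) D) => // y _.
apply: (@continuous_comp _ _ _ (fun y => y - x0) (fun z => `|z|)).
  by apply: continuousB => //; exact: cst_continuous.
exact: norm_continuous.
Qed.

Definition local_minimizer B x : Prop :=
  Q_feasible G c x /\
  exists2 r, 0 < r &
    forall y, Q_feasible G c y -> `|y - x| < r -> qform B x <= qform B y.

(** On the feasible points at distance exactly [e] from [x0] the form [A] has a
    positive minimum: its only feasible zeros are [x0] and [- x0], and the bound
    [e <= `|x0|] keeps [- x0] away. Forms close to [A] therefore still take
    larger values there than at [x0], and their minimum over the feasible points
    of the closed ball is reached in the open ball. *)
Lemma perturbed_local_minimizer A x0 (e : R) :
  psd A -> Q_feasible G c x0 -> qform A x0 = 0 ->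
  (forall y, Q_feasible G c y -> qform A y = 0 -> y = x0 \/ y = - x0) ->
  0 < e -> e <= `|x0| ->
  exists2 eta, 0 < eta & forall B, symmetric_mx B -> `|B - A| < eta ->
    exists2 x, `|x - x0| < e & local_minimizer B x.
Proof.
move=> [symA A_ge0] x0_feas qx0 zeros e_gt0 e_le.
pose S := [set y | Q_feasible G c y /\ `|y - x0| = e].
have [mu mu_gt0 S_mu] : exists2 mu, 0 < mu & forall y, S y -> mu <= qform A y.
  have [[y0 Sy0]|S0] := pselect (S !=set0); last first.
    by exists 1 => // y Sy; case: S0; exists y.
  have S_compact : compact S.
    apply: (@compact_feasible_part x0 e [set r | r = e]) => [|r -> //].
    exact: closed_eq.
  have [|y1 Sy1 min_y1] := compact_EVT_min (ex_intro _ y0 Sy0) S_compact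
    (f := qform A).
    by apply: continuous_subspaceT; exact: continuous_qform.
  exists (qform A y1); last by move=> y Sy; apply: min_y1; rewrite inE.
  move: Sy1; rewrite inE => -[y1_feas y1_e].
  rewrite lt_def A_ge0 andbT; apply/negP => /eqP /(zeros _ y1_feas) [] y1E.
    by move: y1_e; rewrite y1E subrr normr0 => e0; rewrite -e0 ltxx in e_gt0.
  move: y1_e e_le e_gt0; rewrite y1E -opprD normrN -mulr2n normrMn => <-.
  by rewrite mulr2n; lra.
(* All points of the ball have norm at most M, so changing the form by less
   than mu / (2 L) changes its values there by less than mu / 2. *)
pose M := `|x0| + e.
have M_ge0 : 0 <= M by rewrite addr_ge0 // ltW.
pose L := N%:R ^+ 2 * M ^+ 2 + 1.
have L_gt0 : 0 < L by rewrite ltr_wpDl // mulr_ge0 ?sqr_ge0.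
exists (mu / (2 * L)); first by rewrite divr_gt0 // mulr_gt0.
move=> B symB BA.
have B_close y : `|y| <= M -> `|qform B y - qform A y| < mu / 2.
  move=> yM; rewrite -qformMB.
  apply: le_lt_trans (qform_norm_le _ _) _.
  apply: le_lt_trans (_ : `|B - A| * L < _).
    rewrite mulrAC mulrC ler_wpM2l // /L.
    rewrite (le_trans (_ : _ <= N%:R ^+ 2 * M ^+ 2)) ?lerDl //.
    by rewrite ler_wpM2l ?sqr_ge0 // ler_sqr ?nnegrE.
  rewrite -ltr_pdivlMr //; apply: lt_le_trans BA _.
  by rewrite invfM mulrA.
pose K := [set y | Q_feasible G c y /\ `|y - x0| <= e].
have Kx0 : K x0 by split=> //; rewrite subrr normr0 ltW.
have K_compact : compact K.
  apply: (@compact_feasible_part x0 e [set r | r <= e]) => [|r //].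
  exact: closed_le.
have [|x Kx min_x] := compact_EVT_min (ex_intro _ x0 Kx0) K_compact
  (f := qform B).
  by apply: continuous_subspaceT; exact: continuous_qform.
move: Kx; rewrite inE => -[x_feas x_e].
have x_lt : `|x - x0| < e.
  rewrite lt_neqAle x_e andbT; apply/negP => /eqP xe.
  have := S_mu x (conj x_feas xe).
  have := min_x x0; rewrite inE => /(_ Kx0).
  have := B_close x0; rewrite qx0 subr0 lerDl ltW // => /(_ isT).
  have := B_close x _; rewrite !ltr_norml.
  have -> : `|x| <= M.
    by rewrite -[x](subrK x0) addrC (le_trans (ler_normD _ _)) // lerD2l.
  by move=> /(_ isT) /andP[h1 h2] /andP[h3 h4]; lra.
exists x => //; split=> //; exists (e - `|x - x0|); first by rewrite subr_gt0.
move=> y y_feas yx; apply: min_x; rewrite inE; split=> //.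
rewrite -(subrK x y) -addrA (le_trans (ler_normD _ _)) //.
by rewrite -lerBrDr ltW.
Qed.

End LocalMinimizers.

(** * Tangent directions and small Lagrange multipliers *)

Section Multipliers.
Variable R : realType.

Lemma smooth_on_differentiable p q (U : set 'rV[R]_p)
    (f : 'rV[R]_p -> 'rV[R]_q) :
  smooth_on U f -> forall x, U x -> differentiable f x.
Proof. by move=> /(_ 1%N) []. Qed.

Lemma jacobian_diffeo N (U V : set 'rV[R]_N) phi psi y :
  open V -> diffeo U V phi psi -> V y ->
  'J psi y *m 'J phi (psi y) = 1%:M.
Proof.
move=> V_open [phiU psiV phi_smooth psi_smooth] Vy.
have [Upsiy _] := psiV y Vy.
have dpsi := smooth_on_differentiable psi_smooth Vy.
have dphi := smooth_on_differentiable phi_smooth Upsiy.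
apply/row_matrixP => i; rewrite !rowE mulmxA mulmx1 /jacobian !mul_rV_lin1 /=.
move: (delta_mx 0 i) => w.
rewrite -[LHS]/(('d phi (psi y) \o 'd psi y) w) -diff_comp //.
rewrite -deriveE; last exact: differentiable_comp.
have -> : 'D_w (phi \o psi) y = 'D_w id y.
  apply: near_eq_derive; near=> z => /=.
  have [] // := psiV z.
  by near: z; apply: open_nbhs_nbhs.
exact: derive_id.
Unshelve. all: by end_near. Qed.

(** First-order condition: the chain rule identifies the derivative at [0] of
    [t |-> qform B (psi (y + t w))] with twice the value below. *)
Lemma local_min_along_line N (B : 'M[R]_N) (V : set 'rV[R]_N)
    (psi : 'rV[R]_N -> 'rV[R]_N) (y w : 'rV[R]_N) :
  symmetric_mx B -> open V -> V y -> (forall z, V z -> differentiable psi z) ->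
  (\forall t \near (0 : R), qform B (psi y) <= qform B (psi (y + t *: w))) ->
  bform B (psi y) (w *m 'J psi y) = 0.
Proof.
move=> symB V_open Vy dpsi y_min.
pose line (t : R) := y + t *: w.
pose h := qform B \o (psi \o line).
have dline t : is_diff t line ( *:%R^~ w).
  have := is_diffD (is_diff_cst y t) (is_diff_scalel t w).
  by move/is_diff_eq; apply; rewrite add0r.
have line_nbhs : \forall t \near (0 : R), V (line t).
  have [dl _] := dline 0.
  have := differentiable_continuous dl; apply; rewrite /= /line scale0r addr0.
  exact: open_nbhs_nbhs.
have [r /= r_gt0 r_ball] := filterI line_nbhs y_min.
have r_itv t : t \in `](- r), r[ -> ball (0 : R) r t.
  by rewrite in_itv /= -ltr_norml /ball /= sub0r normrN.
have dh t : t \in `](- r), r[ ->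
    is_diff t h (dqform B (psi (line t)) \o ('d psi (line t) \o *:%R^~ w)).
  move=> /r_itv /r_ball [/= Vt _].
  apply: is_diff_comp; last exact: is_diff_qform.
  by apply: is_diff_comp; exact/differentiableP/dpsi.
have zero_itv : (0 : R) \in `](- r), r[ by rewrite in_itv /= oppr_lt0 r_gt0.
have [||||_] := @derive1_at_min R h (- r) r 0; rewrite //.
- by rewrite ge0_cp // ltW.
- by move=> t /dh [dht _]; exact: diff_derivable.
- by move=> t /r_itv /r_ball [_]; rewrite /h /= /line scale0r addr0.
have [dh0 dhE] := dh 0 zero_itv.
rewrite deriveE // dhE /= scale1r /line scale0r addr0 /dqform /jacobian.
by rewrite mul_rV_lin1 => /eqP; rewrite mulf_eq0 pnatr_eq0 /= => /eqP.
Qed.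

Variables (N m : nat) (G : 'I_m -> 'M[R]_N) (c : 'rV[R]_m).
Hypothesis G_sym : forall i, symmetric_mx (G i).

(** The row space of [T] is the tangent space of the feasible set at [x]. Its
    rows are the velocities of the images under [psi] of the first [k] coordinate
    lines; padding with zero rows through [pid_mx k] keeps [T] square. Along these
    curves a local minimizer satisfies the first-order condition. *)
Lemma tangent_matrix (x0 : 'rV[R]_N) k :
  smooth_manifold_near (zero_set (constraint G c)) x0 k ->
  (k <= N)%N /\ exists U : set 'rV[R]_N, [/\ open U, U x0 &
    forall x, U x -> Q_feasible G c x -> exists2 T : 'M[R]_N, \rank T = k &
      forall B, symmetric_mx B -> local_minimizer G c B x -> x *m B *m T^T = 0].
Proof.
move=> [_ [kN [U [V [phi [psi [U_open V_open Ux0 diff_phi straight]]]]]]].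
split=> //; exists U; split=> // x Ux x_feas.
have [phiU psiV phi_smooth psi_smooth] := diff_phi.
have [Vy psiy] := phiU x Ux; set y := phi x in Vy psiy.
exists (pid_mx k *m 'J psi y).
  rewrite mxrankMfree ?rank_pid_mx // row_free_unit.
  have JJ := jacobian_diffeo V_open diff_phi Vy.
  exact: (mulmx1_unit JJ).1.
move=> B symB [_ [r r_gt0 x_min]].
rewrite trmx_mul mulmxA; apply/rowP => j; rewrite [RHS]mxE.
have -> : (x *m B *m ('J psi y)^T *m (pid_mx k)^T) 0 j =
    bform B (psi y) (row j (pid_mx k) *m 'J psi y).
  by rewrite psiy /bform trmx_mul tr_row !colE !mulmxA -colE [RHS]mxE.
apply: (@local_min_along_line _ _ V) => //.
  by move=> z; exact: smooth_on_differentiable.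
set w := row j _.
have dpsi := smooth_on_differentiable psi_smooth Vy.
have line_cont : (fun t : R => y + t *: w) @ (0 : R) --> y.
  rewrite -[X in _ --> X]addr0 -(scale0r w).
  by apply: cvgD; [exact: cvg_cst|apply: cvgZr_tmp; exact: cvg_id].
have psi_cont := differentiable_continuous dpsi.
have V_near : \forall t \near (0 : R), V (y + t *: w).
  by apply: line_cont; exact: open_nbhs_nbhs.
have x_near : \forall t \near (0 : R), `|psi (y + t *: w) - x| < r.
  have psi_line : (fun t : R => psi (y + t *: w)) @ (0 : R) --> x.
    by rewrite -psiy; exact: (cvg_comp _ _ line_cont psi_cont).
  have /cvgrPdist_lt/(_ r r_gt0) := psi_line.
  by apply: filterS => t; rewrite distrC.
near=> t; rewrite psiy; apply: x_min; last by near: t.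
have Vt : V (y + t *: w) by near: t.
have [Ut phit] := psiV _ Vt.
apply/(straight _ Ut) => i ki; rewrite phit !mxE.
have [/(_ x_feas) -> // _] := straight x Ux.
by case: eqP => [->|_] /=; rewrite ?(leq_gtF ki) mulr0 addr0.
Unshelve. all: by end_near. Qed.

End Multipliers.

Section SmallMultipliers.
Variables (R : realType) (N m : nat) (G : 'I_m -> 'M[R]_N) (c : 'rV[R]_m).
Hypothesis G_sym : forall i, symmetric_mx (G i).

Lemma exists_small_factor (K b : R) : 0 <= K -> 0 < b ->
  exists2 e, 0 < e & forall t, 0 <= t -> t < e -> K * t < b.
Proof.
move=> K_ge0 b_gt0; have K1_gt0 : 0 < K + 1 by rewrite ltr_wpDl.
exists (b / (K + 1)) => [|t t_ge0 t_lt]; first by rewrite divr_gt0.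
apply: le_lt_trans (_ : (K + 1) * t < b); first by rewrite ler_wpM2r // lerDl.
by rewrite mulrC -ltr_pdivlMr.
Qed.

(** On the feasible set each form [G i] is constant, so every feasible point is
    a local minimizer of it. *)
Lemma grad_mx_tangent0 x (T : 'M[R]_N) : Q_feasible G c x ->
  (forall B, symmetric_mx B -> local_minimizer G c B x -> x *m B *m T^T = 0) ->
  grad_mx G x *m T^T = 0.
Proof.
move=> x_feas T0; apply/row_matrixP => i.
rewrite row_mul row_grad_mx row0; apply: T0 => //; split=> //.
exists 1 => // y /Q_feasibleP/(_ i)/eqP; rewrite addr_eq0 => /eqP -> _.
by have /Q_feasibleP/(_ i)/eqP := x_feas; rewrite addr_eq0 => /eqP ->.
Qed.

(** Write [r] for the rank of the gradients at [x0], the codimension of the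
    feasible set. A fixed choice [P] of [r] independent combinations of
    gradients remains independent at nearby feasible points [x]: with [J] a right
    inverse at [x0], the map [mu |-> mu M J] is within [1/2] of the identity,
    which gives [M_inj]. As the gradients at [x] are normal to a tangent space of
    dimension [N - r], they span the whole normal space, which contains [x B] at
    a local minimizer. So [x B = mu M] for some [mu], whose size [M_inj] bounds
    by that of [x B], and [- mu P] is the multiplier. *)
Lemma small_multiplier (x0 : 'rV[R]_N) : ACQ (constraint G c) x0 ->
  exists C d : R, [/\ 0 <= C, 0 < d &
    forall B x, symmetric_mx B -> `|x - x0| < d -> local_minimizer G c B x ->
      exists2 l : 'rV[R]_m, x *m lagrangian_mx B G l = 0 &
        `|l| <= C * `|x *m B|].
Proof.
move=> [k [/tangent_matrix [kN [U [U_open Ux0 tangent]]]]].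
rewrite (jacobian_constraint _ G_sym) mxrank_scale_nz ?pnatr_eq0 // mxrank_tr.
set r := \rank _ => rE.
pose M0 := row_base (grad_mx G x0).
have [P M0E] : exists P, M0 = P *m grad_mx G x0.
  by apply/submxP; rewrite eq_row_base.
have /row_freeP [J M0J] : row_free M0 by exact: row_base_free.
pose K := r%:R * (N%:R * (m%:R * `|P| * (N%:R * \sum_i `|G i|)) * `|J|).
have sumG_ge0 : 0 <= \sum_i `|G i| by exact: sumr_ge0.
have K_ge0 : 0 <= K by rewrite !mulr_ge0.
have half_gt0 : 0 < 1 / 2 :> R by lra.
have [d1 d1_gt0 d1K] := exists_small_factor K_ge0 half_gt0.
have [d2 d2_gt0 d2U] : exists2 d, 0 < d & forall x, `|x - x0| < d -> U x.
  have /nbhs_normP [d /= d_gt0 dU] := open_nbhs_nbhs (conj U_open Ux0).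
  by exists d => // x; rewrite distrC => /dU.
exists (r%:R * (2 * (N%:R * `|J|)) * `|P|), (Num.min d1 d2).
split; rewrite ?lt_min ?d1_gt0 ?d2_gt0 //.
move=> B x symB; rewrite lt_min => /andP[xd1 xd2] x_min.
have [x_feas _] := x_min.
have [T rankT T0] := tangent x (d2U x xd2) x_feas.
pose M := P *m grad_mx G x.
have M_inj (mu : 'rV[R]_r) : `|mu| <= 2 * (N%:R * `|J|) * `|mu *m M|.
  have muE : mu *m M *m J = mu + mu *m (P *m grad_mx G (x - x0) *m J).
    rewrite -grad_mxB mulmxBr -M0E mulmxBl M0J mulmxBr mulmx1 -mulmxA.
    by rewrite addrC subrK mulmxA.
  have small : `|mu *m (P *m grad_mx G (x - x0) *m J)| <= 1 / 2 * `|mu|.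
    apply: le_trans (norm_mulmx_le _ _) _.
    rewrite [leLHS]mulrAC ler_wpM2r //; apply: ltW.
    apply: le_lt_trans (d1K _ _ xd1) => //.
    rewrite /K -[leRHS]mulrA ler_wpM2l //.
    apply: le_trans (norm_mulmx_le _ _) _.
    rewrite [leRHS]mulrAC ler_wpM2r // -[leRHS]mulrA ler_wpM2l //.
    apply: le_trans (norm_mulmx_le _ _) _.
    rewrite -[leRHS]mulrA ler_wpM2l ?mulr_ge0 //.
    by apply: le_trans (grad_mx_norm_le _ _) _; rewrite mulrAC.
  have : `|mu| <= `|mu *m M *m J| + 1 / 2 * `|mu|.
    set rest := mu *m (P *m _ *m J) in muE small.
    rewrite -[X in `|X| <= _](addrK rest mu) -muE.
    by apply: le_trans (ler_normB _ _) _; rewrite lerD2l.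
  have := norm_mulmx_le (mu *m M) J.
  have -> : 2 * (N%:R * `|J|) * `|mu *m M| = 2 * (N%:R * `|mu *m M| * `|J|).
    by ring.
  by lra.
have M_free : row_free M.
  rewrite -kermx_eq0; apply/rowV0P => mu /sub_kermxP muM.
  apply/eqP; rewrite -normr_le0; apply: le_trans (M_inj mu) _.
  by rewrite muM normr0 mulr0.
have M_tangent : (M <= kermx T^T)%MS.
  by apply/sub_kermxP; rewrite -mulmxA grad_mx_tangent0 ?mulmx0.
have xB_M : (x *m B <= M)%MS.
  apply: submx_trans (_ : (kermx T^T <= M)%MS); first exact/sub_kermxP/T0.
  rewrite -(mxrank_leqif_sup M_tangent) mxrank_ker mxrank_tr rankT.
  by rewrite -rE.
have /submxP [mu xBE] := xB_M.
exists (- (mu *m P)).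
  by rewrite /lagrangian_mx mulmxDr -mul_grad_mx xBE mulNmx -mulmxA -/M subrr.
rewrite normrN (le_trans (norm_mulmx_le _ _)) // [leRHS]mulrAC ler_wpM2r //.
by rewrite -[leRHS]mulrA ler_wpM2l // xBE; exact: M_inj.
Qed.

End SmallMultipliers.

(** * Stability of the relaxations *)

Section Stability.
Variables (R : realType) (N m : nat) (G : 'I_m -> 'M[R]_N) (c : 'rV[R]_m).
Hypothesis G_sym : forall i, symmetric_mx (G i).

Definition certified_minimizer (B : 'M[R]_N) (x : 'rV[R]_N) (l : 'rV[R]_m) :=
  [/\ Q_feasible G c x, psd (lagrangian_mx B G l),
      qform (lagrangian_mx B G l) x = 0 &
      forall v, qform (lagrangian_mx B G l) v = 0 -> exists a, v = a *: x].

Lemma lagrangian_mx_dist_le (A B : 'M[R]_N) l :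
  `|lagrangian_mx B G l - A| <= `|B - A| + `|l| * \sum_i `|G i|.
Proof.
rewrite /lagrangian_mx addrAC (le_trans (ler_normD _ _)) // lerD2l.
rewrite (le_trans (ler_norm_sum _ _ _)) // mulr_sumr ler_sum // => i _.
by rewrite normrZ ler_wpM2r // mx_entry_le_norm.
Qed.

(** Everything is continuous at [x0], where the multiplier is [0] because
    [x0 A = 0]: for [B] close to [A] the local minimizer [x] stays close to [x0],
    so [x B] is small, hence the multiplier is small, and the Lagrangian matrix is
    a small perturbation of [A] with [x] in its kernel. *)
Lemma near_certified_minimizer (A : 'M[R]_N) (x0 : 'rV[R]_N) :
  psd A -> Q_feasible G c x0 -> qform A x0 = 0 -> x0 != 0 ->
  (forall v, qform A v = 0 -> exists a, v = a *: x0) ->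
  (forall y, Q_feasible G c y -> qform A y = 0 -> y = x0 \/ y = - x0) ->
  ACQ (constraint G c) x0 ->
  exists2 eta, 0 < eta & forall B, symmetric_mx B -> `|B - A| < eta ->
    exists x, exists l, certified_minimizer B x l.
Proof.
move=> Apsd x0_feas qx0 x0_neq0 kerA zeros acq.
have [C [d [C_ge0 d_gt0 multiplier]]] := small_multiplier G_sym acq.
have [eta1 eta1_gt0 stable] := psd_corank1_stable Apsd kerA.
have x0A := psd_qform0 Apsd qx0.
pose s := \sum_i `|G i|.
have s_ge0 : 0 <= s by exact: sumr_ge0.
have q4_gt0 : 0 < eta1 / 4 by rewrite divr_gt0.
have dot_gt0 : 0 < `|(x0 *m x0^T) 0 0|.
  by rewrite normr_gt0; apply: contra x0_neq0 => /eqP /dot_self_eq0 ->.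
have [e1 e1_gt0 e1_dot] : exists2 e, 0 < e &
    forall t, 0 <= t -> t < e -> N%:R * `|x0| * t < `|(x0 *m x0^T) 0 0|.
  by apply: exists_small_factor; rewrite ?mulr_ge0.
have [e2 e2_gt0 e2_A] : exists2 e, 0 < e &
    forall t, 0 <= t -> t < e -> C * s * N%:R * `|A| * t < eta1 / 4.
  by apply: exists_small_factor; rewrite ?mulr_ge0.
have x0_gt0 : 0 < `|x0| by rewrite normr_gt0.
(* The bounds d and e1 keep x in the range of the multiplier lemma and off the
   hyperplane orthogonal to x0; e2, eta3 and eta1 / 4 each keep one of three
   contributions to the distance from A below eta1 / 4. *)
pose e := Num.min (Num.min d `|x0|) (Num.min e1 e2).
have e_gt0 : 0 < e by rewrite !lt_min d_gt0 x0_gt0 e1_gt0.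
have e_le : e <= `|x0| by rewrite /e !ge_min lexx orbT.
have [eta2 eta2_gt0 minimizer] :=
  perturbed_local_minimizer G_sym Apsd x0_feas qx0 zeros e_gt0 e_le.
have [eta3 eta3_gt0 eta3_B] : exists2 h, 0 < h &
    forall t, 0 <= t -> t < h -> C * s * N%:R * (2 * `|x0|) * t < eta1 / 4.
  by apply: exists_small_factor; rewrite ?mulr_ge0.
exists (Num.min eta2 (Num.min eta3 (eta1 / 4))).
  by rewrite !lt_min eta2_gt0 eta3_gt0.
move=> B symB; rewrite !lt_min => /and3P[B2 B3 B1].
have [x + x_min] := minimizer B symB B2; have [x_feas _] := x_min.
rewrite !lt_min => /andP[/andP[xd xx0] /andP[xe1 xe2]].
have [l xH l_le] := multiplier B x symB xd x_min.
have x_le : `|x| <= 2 * `|x0|.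
  have := ler_normD (x - x0) x0; rewrite subrK; move: xx0; lra.
have xB_le : `|x *m B| <=
    N%:R * (2 * `|x0|) * `|B - A| + N%:R * `|A| * `|x - x0|.
  have -> : x *m B = x *m (B - A) + (x - x0) *m A.
    by rewrite mulmxBr mulmxBl x0A subr0 subrK.
  rewrite (le_trans (ler_normD _ _)) // lerD //.
    rewrite (le_trans (norm_mulmx_le _ _)) // -!mulrA ler_wpM2l // mulrA.
    by rewrite ler_wpM2r.
  by rewrite (le_trans (norm_mulmx_le _ _)) // mulrAC.
have dotx : (x *m x0^T) 0 0 != 0.
  apply: contraTneq (e1_dot _ (normr_ge0 (x - x0)) xe1) => dotx0.
  rewrite -leNgt.
  have -> : (x0 *m x0^T) 0 0 = - ((x - x0) *m x0^T) 0 0.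
    rewrite mulmxBl; move: dotx0; move: (x *m _) (x0 *m _) => p q p0.
    by rewrite !mxE p0 add0r opprK.
  rewrite normrN (le_trans (mx_entry_le_norm _ _ _)) //.
  by rewrite (le_trans (norm_mulmx_le _ _)) // norm_trmx mulrAC.
have H_close : `|lagrangian_mx B G l - A| < eta1.
  apply: le_lt_trans (lagrangian_mx_dist_le _ _ _) _; rewrite -/s.
  have h1 := ler_wpM2r s_ge0 l_le.
  have h2 := ler_wpM2l (mulr_ge0 C_ge0 s_ge0) xB_le.
  have h3 := e2_A _ (normr_ge0 (x - x0)) xe2.
  have h4 := eta3_B _ (normr_ge0 (B - A)) B3.
  have h5 : C * s * (N%:R * (2 * `|x0|) * `|B - A| + N%:R * `|A| * `|x - x0|)
    = C * s * N%:R * (2 * `|x0|) * `|B - A| + C * s * N%:R * `|A| * `|x - x0|.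
    by ring.
  rewrite h5 in h2; rewrite mulrAC in h1.
  by lra.
have [Hpsd kerH] := stable _ x (lagrangian_mx_sym symB G_sym l) H_close dotx xH.
exists x, l; split=> //.
by rewrite /qform xH mul0mx mxE.
Qed.

Lemma certified_minimizer_values (B : 'M[R]_N) x l :
  symmetric_mx B -> certified_minimizer B x l ->
  Q_val B G c = P_val B G c /\ P_val B G c = D_val B G c.
Proof.
move=> symB [x_feas Hpsd Hx _].
rewrite (certificate_Q_val symB G_sym x_feas Hpsd Hx).
rewrite (certificate_P_val symB G_sym x_feas Hpsd Hx).
by rewrite (certificate_D_val x_feas Hpsd Hx).
Qed.

Lemma certified_minimizer_recovers (B : 'M[R]_N) x l :
  symmetric_mx B -> c != 0 -> certified_minimizer B x l ->
  P_recovers_minimizer B G c.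
Proof.
move=> symB c_neq0 [x_feas Hpsd Hx Hker].
exact: (certificate_recovers symB G_sym c_neq0 x_feas Hpsd Hx Hker).
Qed.

End Stability.

Theorem theorem3p2 (R : realType) (d N m : nat) (Theta : set 'rV[R]_d)
    (F : 'rV[R]_d -> 'M[R]_N) (G : 'I_m -> 'M[R]_N) (c : 'rV[R]_m)
    (F_sym : forall theta, Theta theta -> symmetric_mx (F theta))
    (F_cont : {within Theta, continuous F})
    (G_sym : forall i, symmetric_mx (G i))
    (c_neq0 : c != 0)
    (thetabar : 'rV[R]_d) (thetabar_in : Theta thetabar)
    (F_psd : psd (F thetabar))
    (F_corank : corank (F thetabar) = 1%N)
    (val_eq0 : Q_val (F thetabar) G c = 0%E)
    (xbar : 'rV[R]_N)
    (xbar_feasible : Q_feasible G c xbar)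
    (xbar_attains : qform (F thetabar) xbar = 0) :
  (forall y, Q_optimal (F thetabar) G c y -> y = xbar \/ y = - xbar) /\
  (ACQ (constraint G c) xbar ->
    SDP_stable_near Theta F G c thetabar /\
    \forall theta \near within Theta (nbhs thetabar),
      P_recovers_minimizer (F theta) G c).
Proof.
have xbar_neq0 : xbar != 0.
  apply: contra c_neq0 => /eqP xbar0; apply/eqP/rowP => i.
  have /Q_feasibleP/(_ i) := xbar_feasible.
  by rewrite xbar0 /qform !mul0mx !mxE add0r.
have kerF v : qform (F thetabar) v = 0 -> exists a, v = a *: xbar.
  exact: (psd_corank1_kernel F_psd F_corank xbar_neq0 xbar_attains).
have zeros y : Q_feasible G c y -> qform (F thetabar) y = 0 ->
    y = xbar \/ y = - xbar.
  move=> y_feas /kerF [a ya]; rewrite ya in y_feas *.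
  exact: (Q_feasible_colinear c_neq0 xbar_feasible).
split=> [y [y_feas y_min]|acq].
  apply: zeros => //; apply/eqP; rewrite eq_le -{1}xbar_attains y_min //.
  by case: F_psd => _ ->.
have [eta eta_gt0 certified] := near_certified_minimizer G_sym F_psd
  xbar_feasible xbar_attains xbar_neq0 kerF zeros acq.
have near_cert : \forall theta \near within Theta (nbhs thetabar),
    symmetric_mx (F theta) /\
    exists x, exists l, certified_minimizer G c (F theta) x l.
  have F_lim : F @ within Theta (nbhs thetabar) --> F thetabar.
    by rewrite nbhs_subspace_in //; exact: F_cont.
  have F_near : \forall theta \near within Theta (nbhs thetabar),
      `|F theta - F thetabar| < eta.
    have /cvgrPdist_lt/(_ eta eta_gt0) := F_lim.
    by apply: filterS => theta; rewrite distrC.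
  near=> theta.
  have theta_in : Theta theta by near: theta; exact: withinT.
  have symF := F_sym theta theta_in; split=> //; apply: certified => //.
  by near: theta.
split; apply: filterS near_cert => theta [symF [x [l cert]]].
  exact: (certified_minimizer_values G_sym symF cert).
exact: (certified_minimizer_recovers G_sym symF c_neq0 cert).
Unshelve. all: by end_near. Qed.
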